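(* Let $(I,e,+)$ be a monoid (with $I$ a set), let $(G_i)_{i:I}$ be a family of abelian groups, and let $\star : G_i \to G_j \to G_{i+j}$ (for all $i,j:I$) together with an element $1_\star : G_e$ be a graded multiplication satisfying the graded ring laws. Then the higher inductive type $\oplus\mathrm{HIT}(I,G)$, equipped with the zero $\mathsf{0\oplus}$, the addition $+_\oplus$, the negation determined by $-(\mathsf{0\oplus}) = \mathsf{0\oplus}$, $-(\mathsf{base}\,n\,x) = \mathsf{base}\,n\,(-x)$ and $-(x +_\oplus y) = (-x) +_\oplus (-y)$, the unit $\mathsf{base}\,e\,1_\star$, and the product determined by $$\mathsf{0\oplus}\cdot y = \mathsf{0\oplus},\quad \mathsf{base}\,n\,x\cdot \mathsf{0\oplus} = \mathsf{0\oplus},\quad \mathsf{base}\,n\,x\cdot \mathsf{base}\,m\,y = \mathsf{base}\,(n+m)\,(x\star y),$$ $$\mathsf{base}\,n\,x\cdot (y +_\oplus z) = (\mathsf{base}\,n\,x\cdot y) +_\oplus (\mathsf{base}\,n\,x\cdot z),\quad (x +_\oplus y)\cdot z = (x\cdot z) +_\oplus (y\cdot z),$$ is a ring.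
   Context: The setting is Homotopy Type Theory / cubical type theory (univalence and higher inductive types), constructively, with no decidable equality assumptions. Groups, rings and monoids have underlying sets (0-types); rings are associative and unital. For a type $I$ and abelian groups $(G_i)_{i:I}$, $\oplus\mathrm{HIT}(I,G)$ is the higher inductive type with point constructors $\mathsf{0\oplus}$; $\mathsf{base}\,n\,x$ for $n:I$, $x:G_n$; and $x +_\oplus y$ for $x,y:\oplus\mathrm{HIT}(I,G)$; and path constructors stating that $+_\oplus$ is associative, has $\mathsf{0\oplus}$ as right unit, is commutative, that $\mathsf{base}\,n\,0 = \mathsf{0\oplus}$, that $\mathsf{base}\,n\,x +_\oplus \mathsf{base}\,n\,y = \mathsf{base}\,n\,(x+y)$, and that the type is a set. The graded ring laws for $\star$ and $1_\star$ are: $0\star y = 0$ and $x\star 0 = 0$; $\star$ distributes on both sides over addition of elements of the same degree; $(x\star y)\star z = x\star(y\star z)$, $x\star 1_\star = x$ and $1_\star\star x = x$, the last three being equalities over the corresponding monoid equalities $(i+j)+k = i+(j+k)$, $i+e=i$, $e+i=i$ in $I$ (i.e. after transport). *)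

(* Defs.v *)
From Stdlib Require Import EqdepFacts.
From Stdlib Require Import ProofIrrelevance FunctionalExtensionality
  PropExtensionality IndefiniteDescription.
Import EqNotations.

Set Implicit Arguments.
Unset Strict Implicit.
Unset Printing Implicit Defensive.

(* Identity types are Rocq's [=], equalities over an equality are equalities
   after the transport [rew [P] p in u].  No type below is assumed to have
   decidable equality, which is why the carriers are plain types with an
   explicit set hypothesis. *)

Definition is_set (A : Type) : Prop := UIP_ A.

Record is_monoid (M : Type) (e : M) (op : M -> M -> M) : Prop := {
  is_monoid_set : is_set M;
  is_monoid_assoc : forall x y z, op (op x y) z = op x (op y z);
  is_monoid_unitr : forall x, op x e = x;
  is_monoid_unitl : forall x, op e x = x
}.

Record is_abgroup (A : Type) (zero : A) (add : A -> A -> A) (opp : A -> A)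
    : Prop := {
  is_abgroup_monoid : is_monoid zero add;
  is_abgroup_oppr : forall x, add x (opp x) = zero;
  is_abgroup_comm : forall x y, add x y = add y x
}.

Record is_ring (R : Type) (zero : R) (add : R -> R -> R) (opp : R -> R)
    (one : R) (mul : R -> R -> R) : Prop := {
  is_ring_abgroup : is_abgroup zero add opp;
  is_ring_monoid : is_monoid one mul;
  is_ring_distl : forall x y z, mul x (add y z) = add (mul x y) (mul x z);
  is_ring_distr : forall x y z, mul (add x y) z = add (mul x z) (mul y z)
}.

Record monoid := Monoid {
  mon_sort :> Type;
  mon_unit : mon_sort;
  mon_op : mon_sort -> mon_sort -> mon_sort;
  mon_ax : is_monoid mon_unit mon_op
}.
Arguments mon_unit : clear implicits.

Record abgroup := AbGroup {
  ab_sort :> Type;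
  ab_zero : ab_sort;
  ab_add : ab_sort -> ab_sort -> ab_sort;
  ab_opp : ab_sort -> ab_sort;
  ab_ax : is_abgroup ab_zero ab_add ab_opp
}.
Arguments ab_zero : clear implicits.

Definition mon_assoc (I : monoid) (i j k : I) :
    mon_op (mon_op i j) k = mon_op i (mon_op j k) :=
  is_monoid_assoc (mon_ax I) i j k.
Definition mon_unitr (I : monoid) (i : I) : mon_op i (mon_unit I) = i :=
  is_monoid_unitr (mon_ax I) i.
Definition mon_unitl (I : monoid) (i : I) : mon_op (mon_unit I) i = i :=
  is_monoid_unitl (mon_ax I) i.

Record graded_ring_laws (I : monoid) (G : I -> abgroup)
    (star : forall i j : I, G i -> G j -> G (mon_op i j))
    (one_star : G (mon_unit I)) : Prop := {
  star_0l : forall (i j : I) (y : G j),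
    star i j (ab_zero (G i)) y = ab_zero (G (mon_op i j));
  star_0r : forall (i j : I) (x : G i),
    star i j x (ab_zero (G j)) = ab_zero (G (mon_op i j));
  star_distl : forall (i j : I) (x : G i) (y z : G j),
    star i j x (ab_add y z) = ab_add (star i j x y) (star i j x z);
  star_distr : forall (i j : I) (x y : G i) (z : G j),
    star i j (ab_add x y) z = ab_add (star i j x z) (star i j y z);
  star_assoc : forall (i j k : I) (x : G i) (y : G j) (z : G k),
    rew [fun l => G l] (mon_assoc i j k) in
      star (mon_op i j) k (star i j x y) z
    = star i (mon_op j k) x (star j k y z);
  star_1r : forall (i : I) (x : G i),
    rew [fun l => G l] (mon_unitr i) in star i (mon_unit I) x one_star = x;
  star_1l : forall (i : I) (x : G i),
    rew [fun l => G l] (mon_unitl i) in star (mon_unit I) i one_star x = x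
}.

(* Rocq has no higher inductive types, so the type is specified by its rules:
   an [oplusHIT G] is a type with the point and path constructors and the
   dependent eliminator they generate.  The clause of the eliminator for the
   set constructor is the requirement that the motive be a family of sets.
   The computation rules on point constructors are identities; those on path
   constructors are identities between identities in a set, hence automatic. *)
Record oplusHIT (I : Type) (G : I -> abgroup) := OplusHIT {
  oplus_sort :> Type;
  oplus0 : oplus_sort;
  oplus_base : forall n : I, G n -> oplus_sort;
  oplus_add : oplus_sort -> oplus_sort -> oplus_sort;
  oplus_assoc : forall x y z,
    oplus_add x (oplus_add y z) = oplus_add (oplus_add x y) z;
  oplus_rid : forall x, oplus_add x oplus0 = x;
  oplus_comm : forall x y, oplus_add x y = oplus_add y x;
  oplus_base0 : forall n, oplus_base (ab_zero (G n)) = oplus0;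
  oplus_baseD : forall n (x y : G n),
    oplus_add (oplus_base x) (oplus_base y) = oplus_base (ab_add x y);
  oplus_set : is_set oplus_sort;
  oplus_elim : forall (P : oplus_sort -> Type)
      (P_set : forall x, is_set (P x))
      (p0 : P oplus0)
      (pbase : forall n (x : G n), P (oplus_base x))
      (padd : forall x y, P x -> P y -> P (oplus_add x y))
      (passoc : forall x y z (u : P x) (v : P y) (w : P z),
        rew [P] (oplus_assoc x y z) in padd _ _ u (padd _ _ v w)
        = padd _ _ (padd _ _ u v) w)
      (prid : forall x (u : P x), rew [P] (oplus_rid x) in padd _ _ u p0 = u)
      (pcomm : forall x y (u : P x) (v : P y),
        rew [P] (oplus_comm x y) in padd _ _ u v = padd _ _ v u)
      (pbase0 : forall n,
        rew [P] (oplus_base0 n) in pbase n (ab_zero (G n)) = p0)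
      (pbaseD : forall n (x y : G n),
        rew [P] (oplus_baseD x y) in padd _ _ (pbase n x) (pbase n y)
        = pbase n (ab_add x y)),
    { f : forall x, P x |
      f oplus0 = p0
      /\ (forall n (x : G n), f (oplus_base x) = pbase n x)
      /\ (forall x y, f (oplus_add x y) = padd x y (f x) (f y)) }
}.
Arguments oplus0 {I G} o.
Arguments oplus_base {I G} o n _.
Arguments oplus_add {I G o} _ _.
Arguments oplus_set {I G} o.
Arguments oplus_elim {I G} o P.

Record oplus_neg_eqs (I : Type) (G : I -> abgroup) (D : oplusHIT G)
    (neg : D -> D) : Prop := {
  neg_0 : neg (oplus0 D) = oplus0 D;
  neg_base : forall n (x : G n),
    neg (oplus_base D n x) = oplus_base D n (ab_opp x);
  neg_add : forall x y : D, neg (oplus_add x y) = oplus_add (neg x) (neg y)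
}.

Record oplus_mul_eqs (I : monoid) (G : I -> abgroup)
    (star : forall i j : I, G i -> G j -> G (mon_op i j))
    (D : oplusHIT G) (mul : D -> D -> D) : Prop := {
  mul_0 : forall y : D, mul (oplus0 D) y = oplus0 D;
  mul_base_0 : forall n (x : G n),
    mul (oplus_base D n x) (oplus0 D) = oplus0 D;
  mul_base_base : forall n m (x : G n) (y : G m),
    mul (oplus_base D n x) (oplus_base D m y)
    = oplus_base D (mon_op n m) (star n m x y);
  mul_base_add : forall n (x : G n) (y z : D),
    mul (oplus_base D n x) (oplus_add y z)
    = oplus_add (mul (oplus_base D n x) y) (mul (oplus_base D n x) z);
  mul_add : forall x y z : D,
    mul (oplus_add x y) z = oplus_add (mul x z) (mul y z)
}.

(* The rules of [oplusHIT] are satisfiable: with proof irrelevance and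
   choice, the quotient of formal sums by the congruence generated by the path
   constructors is a model.  Nothing else depends on these axioms. *)
Module Model.
Section Model.
Context (I : Type) (G : I -> abgroup).

Inductive term : Type :=
| T0 : term
| Tbase (n : I) (x : G n) : term
| Tadd : term -> term -> term.

Inductive rel : term -> term -> Prop :=
| rel_refl t : rel t t
| rel_sym t u : rel t u -> rel u t
| rel_trans t u v : rel t u -> rel u v -> rel t v
| rel_congr t t' u u' : rel t t' -> rel u u' -> rel (Tadd t u) (Tadd t' u')
| rel_assoc t u v : rel (Tadd t (Tadd u v)) (Tadd (Tadd t u) v)
| rel_rid t : rel (Tadd t T0) t
| rel_comm t u : rel (Tadd t u) (Tadd u t)
| rel_base0 n : rel (Tbase (ab_zero (G n))) T0
| rel_baseD n (x y : G n) :
    rel (Tadd (Tbase x) (Tbase y)) (Tbase (ab_add x y)).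

Definition quot : Type := { S : term -> Prop | exists t, S = rel t }.

Definition class (t : term) : quot :=
  exist _ (rel t) (ex_intro _ t eq_refl).

Lemma class_eq t u : rel t u -> class t = class u.
Proof.
intros H; unfold class; apply subset_eq_compat.
apply functional_extensionality; intros v; apply propositional_extensionality.
split; intros K; [ apply rel_trans with t | apply rel_trans with u ];
  auto using rel_sym.
Qed.

Lemma class_rel t u : class t = class u -> rel t u.
Proof.
intros H; apply (f_equal (@proj1_sig _ _)) in H; simpl in H.
rewrite H; apply rel_refl.
Qed.

Lemma class_onto (q : quot) : exists t, class t = q.
Proof.
destruct q as [S [t Ht]]; exists t; apply subset_eq_compat; congruence.
Qed.

Definition rep (q : quot) : term :=
  proj1_sig (constructive_indefinite_description _ (class_onto q)).

Lemma repK q : class (rep q) = q.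
Proof.
exact (proj2_sig (constructive_indefinite_description _ (class_onto q))).
Qed.

Lemma rep_class t : rel (rep (class t)) t.
Proof. apply class_rel, repK. Qed.

Definition add (p q : quot) : quot := class (Tadd (rep p) (rep q)).

Lemma add_class t u : add (class t) (class u) = class (Tadd t u).
Proof. apply class_eq, rel_congr; apply rep_class. Qed.

Lemma quot_ind (P : quot -> Prop) : (forall t, P (class t)) -> forall q, P q.
Proof. intros H q; rewrite <- (repK q); apply H. Qed.

Lemma add_assoc x y z : add x (add y z) = add (add x y) z.
Proof.
revert x y z; refine (quot_ind _); intros t; refine (quot_ind _); intros u.
refine (quot_ind _); intros v; rewrite !add_class; apply class_eq, rel_assoc.
Qed.

Lemma add_rid x : add x (class T0) = x.
Proof.
revert x; refine (quot_ind _); intros t; rewrite add_class.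
apply class_eq, rel_rid.
Qed.

Lemma add_comm x y : add x y = add y x.
Proof. apply class_eq, rel_comm. Qed.

Lemma base0 n : class (Tbase (ab_zero (G n))) = class T0.
Proof. apply class_eq, rel_base0. Qed.

Lemma baseD n (x y : G n) :
  add (class (Tbase x)) (class (Tbase y)) = class (Tbase (ab_add x y)).
Proof. rewrite add_class; apply class_eq, rel_baseD. Qed.

Lemma sig_rew (P : quot -> Type) x y (e : x = y) (u : P x) (v : P y) :
  rew [P] e in u = v -> existT P x u = existT P y v.
Proof. destruct e; simpl; intros ->; reflexivity. Qed.

Lemma exists_oplusHIT : inhabited (oplusHIT G).
Proof.
constructor.
refine (@OplusHIT I G quot (class T0) (fun n x => class (Tbase x)) add
  add_assoc add_rid add_comm base0 baseD _ _).
{ intros x y p q; apply proof_irrelevance. }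
intros P _ p0 pbase padd passoc prid pcomm pbase0 pbaseD.
pose (sadd := fun a b : sigT P => existT P (add (projT1 a) (projT1 b))
        (padd _ _ (projT2 a) (projT2 b))).
pose (f := fix f (t : term) : sigT P := match t with
  | T0 => existT P _ p0
  | Tbase x => existT P _ (pbase _ x)
  | Tadd t u => sadd (f t) (f u)
  end).
assert (f1 : forall t, projT1 (f t) = class t).
{ induction t as [|n x|t IHt u IHu]; simpl; auto.
  rewrite IHt, IHu; apply add_class. }
assert (fR : forall t u, rel t u -> f t = f u).
{ induction 1 as [| | |t t' u u' _ IHt _ IHu|t u v|t|t u|n|n x y]; simpl;
    try congruence.
  - destruct (f t), (f u), (f v); exact (sig_rew (passoc _ _ _ _ _ _)).
  - destruct (f t); exact (sig_rew (prid _ _)).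
  - destruct (f t), (f u); exact (sig_rew (pcomm _ _ _ _)).
  - exact (sig_rew (pbase0 n)).
  - exact (sig_rew (pbaseD n x y)). }
assert (fq : forall q, projT1 (f (rep q)) = q).
{ intros q; rewrite f1; apply repK. }
pose (g := fun q => rew [P] (fq q) in projT2 (f (rep q))).
assert (gE : forall q, existT P q (g q) = f (rep q)).
{ intros q; unfold g; generalize (fq q); destruct (f (rep q)) as [x u]; simpl.
  intros e; destruct e; reflexivity. }
exists g; split; [|split].
- apply (inj_pairT2 _ P); rewrite gE; exact (fR _ _ (rep_class T0)).
- intros n x; apply (inj_pairT2 _ P); rewrite gE.
  exact (fR _ _ (rep_class (Tbase x))).
- intros x y; apply (inj_pairT2 _ P); rewrite gE.
  transitivity (f (Tadd (rep x) (rep y))).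
  { exact (fR _ _ (rep_class (Tadd (rep x) (rep y)))). }
  simpl; rewrite <- (gE x), <- (gE y); reflexivity.
Qed.

End Model.
End Model.

(* Main.v *)
Require Import Defs.
From Stdlib Require Import EqdepFacts.
Import EqNotations.

Set Implicit Arguments.
Unset Strict Implicit.
Unset Printing Implicit Defensive.

(** The type [oplusHIT G] is the direct sum of the [G n]: homomorphisms out of
    it into a commutative monoid [A] correspond to families of homomorphisms
    [G n -> A] ([oplus_rec] for existence, [oplus_hom_ext] for uniqueness).
    Associativity, commutativity and the unit law of the addition are path
    constructors.  Every other law says that two expressions agree which are
    additive in each variable.  So, by uniqueness, one variable at a time, it
    suffices to check the law on the generators [base n x], where it is an
    abelian group law of [G n], a graded ring law or a defining equation of the
    product.

    The negation is the homomorphism induced by the negations of the [G n].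
    The product is obtained by two nested uses of [oplus_rec]: for fixed
    [base n x], the maps [base m y |-> base (n + m) (star x y)] induce left
    multiplication by [base n x]; for fixed [y], the maps
    [x |-> base n x * y] then induce right multiplication by [y].  Recursing on
    the first argument with [y] fixed keeps all values in the direct sum, so
    that no equality between functions is involved and function extensionality
    is avoided.

    The graded laws that hold over an equality [i = j] of degrees become plain
    equalities in the direct sum, because [base] identifies an element with
    its transports ([oplus_base_rew]). *)

(** * Abelian groups *)

Section AbelianGroup.
Context (A : abgroup).
Implicit Types x y : A.

Lemma ab_assoc x y z : ab_add (ab_add x y) z = ab_add x (ab_add y z).
Proof. apply (is_monoid_assoc (is_abgroup_monoid (ab_ax A))). Qed.

Lemma ab_add0 x : ab_add x (ab_zero A) = x.
Proof. apply (is_monoid_unitr (is_abgroup_monoid (ab_ax A))). Qed.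

Lemma ab_comm x y : ab_add x y = ab_add y x.
Proof. apply (is_abgroup_comm (ab_ax A)). Qed.

Lemma ab_addN x : ab_add x (ab_opp x) = ab_zero A.
Proof. apply (is_abgroup_oppr (ab_ax A)). Qed.

Lemma ab_opp_unique x y : ab_add x y = ab_zero A -> ab_opp x = y.
Proof.
intros H.
rewrite <- (ab_add0 (ab_opp x)), <- H, <- ab_assoc, (ab_comm (ab_opp x)).
rewrite ab_addN, ab_comm; apply ab_add0.
Qed.

Lemma ab_opp0 : ab_opp (ab_zero A) = ab_zero A.
Proof. apply ab_opp_unique, ab_add0. Qed.

Lemma ab_oppD x y : ab_opp (ab_add x y) = ab_add (ab_opp x) (ab_opp y).
Proof.
apply ab_opp_unique.
rewrite (ab_comm x), ab_assoc, <- (ab_assoc x), ab_addN.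
rewrite (ab_comm (ab_zero A)), ab_add0; apply ab_addN.
Qed.

End AbelianGroup.

(** * The universal property of the direct sum *)

Lemma is_set_eq (A : Type) (a b : A) : is_set A -> is_set (a = b).
Proof.
intros HA p; destruct p; intros q r; destruct r; intros s.
symmetry; apply UIP_shift; intros c e; apply HA.
Qed.

Section UniversalProperty.
Context (I : Type) (G : I -> abgroup) (D : oplusHIT G).
Context (A : Type) (zero : A) (add : A -> A -> A).
Hypothesis A_monoid : is_monoid zero add.

Record oplus_hom (f : D -> A) : Prop := {
  oplus_hom0 : f (oplus0 D) = zero;
  oplus_homD : forall x y, f (oplus_add x y) = add (f x) (f y)
}.

(** In the eliminator applied to the motive [f x = g x], the clauses for the
    path constructors are equalities between identities of the set [A]. *)
Lemma oplus_hom_ext (f g : D -> A) :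
  oplus_hom f -> oplus_hom g ->
  (forall n (x : G n), f (oplus_base D n x) = g (oplus_base D n x)) ->
  forall x, f x = g x.
Proof.
intros Hf Hg Hbase.
pose proof (is_monoid_set A_monoid) as A_set.
assert (H0 : f (oplus0 D) = g (oplus0 D)).
{ now rewrite (oplus_hom0 Hf), (oplus_hom0 Hg). }
assert (HD : forall x y, f x = g x -> f y = g y ->
          f (oplus_add x y) = g (oplus_add x y)).
{ intros x y Hx Hy; rewrite (oplus_homD Hf), (oplus_homD Hg); congruence. }
refine (proj1_sig (oplus_elim D (fun x => f x = g x) _ H0 Hbase HD _ _ _ _ _));
  intros; (apply is_set_eq, A_set || apply A_set).
Qed.

Hypothesis add_comm : forall a b, add a b = add b a.

Lemma oplus_rec (phi : forall n, G n -> A) :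
  (forall n, phi n (ab_zero (G n)) = zero) ->
  (forall n (x y : G n), phi n (ab_add x y) = add (phi n x) (phi n y)) ->
  { f : D -> A | oplus_hom f /\ forall n x, f (oplus_base D n x) = phi n x }.
Proof.
intros phi0 phiD.
destruct (oplus_elim D (fun _ => A) (fun _ => is_monoid_set A_monoid) zero phi
  (fun _ _ => add)) as [f [f0 [fbase fadd]]]; intros; rewrite ?rew_const.
- symmetry; apply (is_monoid_assoc A_monoid).
- apply (is_monoid_unitr A_monoid).
- apply add_comm.
- apply phi0.
- symmetry; apply phiD.
- exists f; repeat split; assumption.
Qed.

Lemma oplus_hom_const0 : oplus_hom (fun _ => zero).
Proof. split; intros; now rewrite ?(is_monoid_unitr A_monoid). Qed.

Lemma oplus_hom_add (f g : D -> A) :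
  oplus_hom f -> oplus_hom g -> oplus_hom (fun x => add (f x) (g x)).
Proof.
intros Hf Hg; split.
- rewrite (oplus_hom0 Hf), (oplus_hom0 Hg); apply (is_monoid_unitr A_monoid).
- intros x y; rewrite (oplus_homD Hf), (oplus_homD Hg).
  rewrite !(is_monoid_assoc A_monoid); f_equal.
  rewrite <- !(is_monoid_assoc A_monoid); f_equal; apply add_comm.
Qed.

End UniversalProperty.

(** * The additive group *)

Section AdditiveGroup.
Context (I : Type) (G : I -> abgroup) (D : oplusHIT G).

Local Notation oplus_endo := (oplus_hom (oplus0 D) (@oplus_add _ _ D)).

Lemma oplus_monoid : is_monoid (oplus0 D) oplus_add.
Proof.
split.
- apply oplus_set.
- intros; symmetry; apply oplus_assoc.
- apply oplus_rid.
- intros; rewrite oplus_comm; apply oplus_rid.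
Qed.

Lemma oplus_endo_id : oplus_endo (fun x => x).
Proof. now split. Qed.

Lemma oplus_endo_comp (f g : D -> D) :
  oplus_endo f -> oplus_endo g -> oplus_endo (fun x => f (g x)).
Proof.
intros Hf Hg; split; intros.
- now rewrite (oplus_hom0 Hg), (oplus_hom0 Hf).
- now rewrite (oplus_homD Hg), (oplus_homD Hf).
Qed.

Lemma oplus_base_rew (i j : I) (p : i = j) (x : G i) :
  oplus_base D i x = oplus_base D j (rew [fun l => G l] p in x).
Proof. now destruct p. Qed.

Lemma oplus_neg_exists : { neg : D -> D | oplus_neg_eqs neg }.
Proof.
destruct (oplus_rec D oplus_monoid (@oplus_comm _ _ D)
  (phi := fun n x => oplus_base D n (ab_opp x))) as [neg [Hneg Hbase]].
- intros n; rewrite ab_opp0; apply oplus_base0.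
- intros n x y; rewrite oplus_baseD; f_equal; apply ab_oppD.
- exists neg; split; [apply Hneg | exact Hbase | apply Hneg].
Qed.

Lemma oplus_neg_endo (neg : D -> D) : oplus_neg_eqs neg -> oplus_endo neg.
Proof. intros H; split; apply H. Qed.

Lemma oplus_neg_unique (neg neg' : D -> D) :
  oplus_neg_eqs neg -> oplus_neg_eqs neg' -> forall x, neg' x = neg x.
Proof.
intros H H'; apply (oplus_hom_ext oplus_monoid); auto using oplus_neg_endo.
intros n x; now rewrite (neg_base H), (neg_base H').
Qed.

Lemma oplus_abgroup (neg : D -> D) :
  oplus_neg_eqs neg -> is_abgroup (oplus0 D) oplus_add neg.
Proof.
intros Hneg; split; [apply oplus_monoid | | apply oplus_comm].
apply (oplus_hom_ext oplus_monoid).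
- apply (oplus_hom_add oplus_monoid (@oplus_comm _ _ D) oplus_endo_id).
  now apply oplus_neg_endo.
- apply oplus_hom_const0, oplus_monoid.
- intros n x; rewrite (neg_base Hneg), oplus_baseD, ab_addN; apply oplus_base0.
Qed.

End AdditiveGroup.

(** * The product *)

Section Product.
Context (I : monoid) (G : I -> abgroup).
Context (star : forall i j : I, G i -> G j -> G (mon_op i j)).
Context (one_star : G (mon_unit I)).
Hypothesis Hstar : graded_ring_laws star one_star.
Context (D : oplusHIT G).

Local Notation oplus_endo := (oplus_hom (oplus0 D) (@oplus_add _ _ D)).

Let D_monoid := oplus_monoid D.
Let D_comm := @oplus_comm _ _ D.

Lemma oplus_lmul_base_exists n (x : G n) :
  { l : D -> D | oplus_endo l /\ forall m (y : G m),
      l (oplus_base D m y) = oplus_base D (mon_op n m) (star x y) }.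
Proof.
apply (oplus_rec D D_monoid D_comm
  (phi := fun m y => oplus_base D (mon_op n m) (star x y))).
- intros m; rewrite (star_0r Hstar); apply oplus_base0.
- intros m y z; rewrite (star_distl Hstar); symmetry; apply oplus_baseD.
Qed.

(** The recursion on the first argument requires that [base n x * y] be
    additive in [x]; this holds because both sides of each equation are
    additive in [y] and agree on generators. *)
Lemma oplus_mul_exists : { mul : D -> D -> D | oplus_mul_eqs star mul }.
Proof.
pose (lmul := fun n (x : G n) => proj1_sig (oplus_lmul_base_exists x)).
assert (lmul_endo : forall n x, oplus_endo (lmul n x)).
{ intros n x; exact (proj1 (proj2_sig (oplus_lmul_base_exists x))). }
assert (lmul_base : forall n x m (y : G m), lmul n x (oplus_base D m y)
          = oplus_base D (mon_op n m) (star x y)).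
{ intros n x; exact (proj2 (proj2_sig (oplus_lmul_base_exists x))). }
assert (rmul : forall y : D, { r : D -> D |
          oplus_endo r /\ forall n x, r (oplus_base D n x) = lmul n x y }).
{ intros y.
  apply (oplus_rec D D_monoid D_comm (phi := fun n x => lmul n x y)); intros n.
  - revert y; apply (oplus_hom_ext D_monoid); auto.
    + now apply oplus_hom_const0.
    + intros m y; rewrite lmul_base, (star_0l Hstar); apply oplus_base0.
  - intros x x'; revert y; apply (oplus_hom_ext D_monoid); auto.
    + now apply (oplus_hom_add D_monoid D_comm).
    + intros m y; rewrite !lmul_base, oplus_baseD.
      now rewrite (star_distr Hstar). }
exists (fun x y => proj1_sig (rmul y) x).
assert (rmul_endo : forall y, oplus_endo (proj1_sig (rmul y))).
{ intros y; apply (proj2_sig (rmul y)). }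
assert (rmul_base : forall y n x,
          proj1_sig (rmul y) (oplus_base D n x) = lmul n x y).
{ intros y; apply (proj2_sig (rmul y)). }
split; intros.
- apply (oplus_hom0 (rmul_endo _)).
- rewrite rmul_base; apply (oplus_hom0 (lmul_endo _ _)).
- rewrite rmul_base; apply lmul_base.
- rewrite !rmul_base; apply (oplus_homD (lmul_endo _ _)).
- apply (oplus_homD (rmul_endo _)).
Qed.

Section Laws.
Context (mul : D -> D -> D).
Hypothesis Hmul : oplus_mul_eqs star mul.

Lemma oplus_rmul_endo (y : D) : oplus_endo (fun x => mul x y).
Proof. split; intros; apply Hmul. Qed.

(** The equations of the product give additivity in the second argument only
    when the first one is a generator; additivity in the first argument
    extends it. *)
Lemma oplus_lmul_endo (x : D) : oplus_endo (mul x).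
Proof.
split; [ | intros y z]; revert x; apply (oplus_hom_ext D_monoid);
  auto using oplus_rmul_endo.
- now apply oplus_hom_const0.
- apply (mul_base_0 Hmul).
- apply (oplus_hom_add D_monoid D_comm); apply oplus_rmul_endo.
- intros n x; apply (mul_base_add Hmul).
Qed.

Lemma oplus_mul_unique (mul' : D -> D -> D) :
  oplus_mul_eqs star mul' -> forall x y, mul' x y = mul x y.
Proof.
intros Hmul' x y; revert x; apply (oplus_hom_ext D_monoid).
- split; intros; apply Hmul'.
- apply oplus_rmul_endo.
- intros n x; revert y; apply (oplus_hom_ext D_monoid).
  + split; intros; apply Hmul'.
  + apply oplus_lmul_endo.
  + intros m y; now rewrite (mul_base_base Hmul), (mul_base_base Hmul').
Qed.

Lemma oplus_mul_assoc (x y z : D) : mul (mul x y) z = mul x (mul y z).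
Proof.
revert x; apply (oplus_hom_ext D_monoid).
- exact (oplus_endo_comp (oplus_rmul_endo z) (oplus_rmul_endo y)).
- apply oplus_rmul_endo.
- intros i x; revert y; apply (oplus_hom_ext D_monoid).
  + exact (oplus_endo_comp (oplus_rmul_endo z) (oplus_lmul_endo _)).
  + exact (oplus_endo_comp (oplus_lmul_endo _) (oplus_rmul_endo z)).
  + intros j y; revert z; apply (oplus_hom_ext D_monoid).
    * apply oplus_lmul_endo.
    * exact (oplus_endo_comp (oplus_lmul_endo _) (oplus_lmul_endo _)).
    * intros k z; rewrite !(mul_base_base Hmul), <- (star_assoc Hstar).
      apply oplus_base_rew.
Qed.

Lemma oplus_mul_monoid :
  is_monoid (oplus_base D (mon_unit I) one_star) mul.
Proof.
split.
- apply oplus_set.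
- apply oplus_mul_assoc.
- apply (oplus_hom_ext D_monoid); [apply oplus_rmul_endo | apply oplus_endo_id |].
  intros n x; rewrite (mul_base_base Hmul), (oplus_base_rew D (mon_unitr n)).
  now rewrite (star_1r Hstar).
- apply (oplus_hom_ext D_monoid); [apply oplus_lmul_endo | apply oplus_endo_id |].
  intros n x; rewrite (mul_base_base Hmul), (oplus_base_rew D (mon_unitl n)).
  now rewrite (star_1l Hstar).
Qed.

End Laws.
End Product.

Theorem mainTheorem1 (I : monoid) (G : I -> abgroup)
    (star : forall i j : I, G i -> G j -> G (mon_op i j))
    (one_star : G (mon_unit I))
    (Hstar : graded_ring_laws star one_star)
    (D : oplusHIT G) :
  { neg : D -> D & { mul : D -> D -> D |
      (oplus_neg_eqs neg
        /\ forall neg' : D -> D, oplus_neg_eqs neg' ->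
             forall x, neg' x = neg x)
      /\ (oplus_mul_eqs star mul
        /\ forall mul' : D -> D -> D, oplus_mul_eqs star mul' ->
             forall x y, mul' x y = mul x y)
      /\ is_ring (oplus0 D) oplus_add neg
           (oplus_base D (mon_unit I) one_star) mul } }.
Proof.
destruct (oplus_neg_exists D) as [neg Hneg].
destruct (oplus_mul_exists Hstar D) as [mul Hmul].
exists neg, mul; split; [ | split; [ | split]].
- split; [exact Hneg | intros neg'; now apply oplus_neg_unique].
- split; [exact Hmul | now apply oplus_mul_unique].
- now apply oplus_abgroup.
- now apply (oplus_mul_monoid Hstar).
- intros x; apply (oplus_homD (oplus_lmul_endo Hmul x)).
- apply (mul_add Hmul).
Qed.
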